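(* Let $z$ be an integer with $z>2$. The average path length $\overline{D_t}$ of $G_t^z$ satisfies $$\lim_{t\to\infty}\frac{\overline{D_t}}{t}=\frac{4(z-1)}{z^{2}}.$$
   Context: Fix an integer $z>2$. The finite simple graphs $G_t^z$ ($t=0,1,2,\dots$), each with a distinguished vertex called its root (its largest, original hub node) and a distinguished set of vertices called its last-layer bottom nodes, are defined recursively. $G_0^z$ is a triangle; one of its vertices is the root (hub node) and the other two are its (last-layer) bottom nodes. For $t\ge1$, $G_t^z$ is formed from the disjoint union of $z$ copies of $G_{t-1}^z$, one called the original and the other $z-1$ called replicas, by adding an edge from the root of the original copy to every last-layer bottom node of each of the $z-1$ replicas. The root of $G_t^z$ is the root of the original copy, and the last-layer bottom nodes of $G_t^z$ are the last-layer bottom nodes of all $z-1$ replicas. Let $N_t=3z^t$ be the number of vertices of $G_t^z$ and let $D_t$ be the sum of the shortest-path distances over all unordered pairs of distinct vertices of $G_t^z$. The average path length is $\overline{D_t}=\frac{D_t}{N_t(N_t-1)/2}$. *)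

(* Defs.v *)
From mathcomp Require Import all_boot all_order all_algebra.
From mathcomp Require Import all_classical all_reals all_analysis.

Set Implicit Arguments.
Unset Strict Implicit.
Unset Printing Implicit Defensive.

Import Order.TTheory GRing.Theory Num.Theory.

Record rootedGraph := RootedGraph {
  vertex :> finType;
  adj : rel vertex;
  adj_sym : symmetric adj;
  adj_irr : irreflexive adj;
  hub : vertex;
  bottom : {set vertex} }.

Lemma triangle_sym : symmetric (fun i j : 'I_3 => i != j).
Proof. by move=> i j; rewrite eq_sym. Qed.

Lemma triangle_irr : irreflexive (fun i j : 'I_3 => i != j).
Proof. by move=> i; rewrite eqxx. Qed.

Definition triangle : rootedGraph :=
  @RootedGraph 'I_3 (fun i j => i != j) triangle_sym triangle_irr
    ord0 [set i | i != ord0].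

Section Step.
Variables (z : nat) (G : rootedGraph).

(* [None] tags the original copy, [Some i] the replicas, so that there are
   [z] copies in all as soon as [0 < z]. *)
Definition step_vertex : finType := (option 'I_z.-1 * G)%type.

Definition hub_bottom (u v : step_vertex) : bool :=
  [&& u.1 == None, u.2 == hub G, v.1 != None & v.2 \in bottom G].

Definition step_adj : rel step_vertex := fun u v =>
  [|| (u.1 == v.1) && adj u.2 v.2, hub_bottom u v | hub_bottom v u].

Lemma step_adj_sym : symmetric step_adj.
Proof.
by move=> u v; rewrite /step_adj [v.1 == _]eq_sym [adj v.2 _]adj_sym
  [hub_bottom v u || _]orbC.
Qed.

Lemma step_adj_irr : irreflexive step_adj.
Proof.
move=> u; rewrite /step_adj adj_irr andbF orbb /=.
by rewrite /hub_bottom; case: (u.1 == None); rewrite //= andbF.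
Qed.

Definition step : rootedGraph :=
  @RootedGraph step_vertex step_adj step_adj_sym step_adj_irr
    (None, hub G) [set u | (u.1 != None) && (u.2 \in bottom G)].

End Step.

Definition hgraph (z t : nat) : rootedGraph := iter t (step z) triangle.

Lemma card_hgraph (z t : nat) : 0 < z -> #|hgraph z t| = 3 * z ^ t.
Proof.
move=> z_gt0; elim: t => [|t IHt]; first by rewrite card_ord.
by rewrite card_prod card_option card_ord prednK // IHt expnS mulnCA.
Qed.

(* Least length of a walk from [x] to [y]; the search can be limited to lengths
   below [#|G|] since a shortest walk repeats no vertex. The value is [#|G|]
   when [x] and [y] are not connected. *)
Definition dist (G : rootedGraph) (x y : G) : nat :=
  find (fun k => [exists p : k.-tuple G, path (@adj G) x p && (last x p == y)])
       (iota 0 #|G|).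

Lemma distP (G : rootedGraph) (x y : G) : connect (@adj G) x y ->
  (exists p : seq G,
     [/\ path (@adj G) x p, last x p = y & size p = dist x y]) /\
  (forall p : seq G, path (@adj G) x p -> last x p = y -> dist x y <= size p).
Proof.
set P := fun k => [exists p : k.-tuple G, path (@adj G) x p && (last x p == y)].
have short p : path (@adj G) x p -> last x p = y ->
    exists2 k, k <= size p & (k < #|G|) && P k.
  move=> xp lp; case: (shortenP xp) lp => q xq uq sq lq.
  have uq' : uniq q by case/andP: uq.
  exists (size q); first exact: uniq_leq_size.
  apply/andP; split; last by apply/existsP; exists (in_tuple q); rewrite xq lq eqxx.
  by rewrite -[(size q).+1]/(size (x :: q)) -(card_uniqP uq) max_card.
have low k : k < #|G| -> P k -> dist x y <= k.
  move=> kG Pk; rewrite leqNgt; apply/negP => /(before_find 0).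
  by rewrite nth_iota // add0n -/(P k) Pk.
case/connectP=> p0 xp0 lp0; split; last first.
  move=> p xp lp; have [k kp /andP[kG Pk]] := short p xp lp.
  exact: leq_trans (low k kG Pk) kp.
have [k _ /andP[kG Pk]] := short p0 xp0 (esym lp0).
have hP : has P (iota 0 #|G|) by apply/hasP; exists k; rewrite // mem_iota.
have := nth_find 0 hP; move: (hP); rewrite has_find size_iota => lt.
rewrite nth_iota // add0n => /existsP[p /andP[xp /eqP lp]].
by exists p; split=> //; rewrite size_tuple.
Qed.

Lemma hgraph_connected (z t : nat) : 1 < z ->
  forall x y : hgraph z t, connect (@adj (hgraph z t)) x y.
Proof.
move=> z_gt1.
have bot s : exists b, b \in bottom (hgraph z s).
  elim: s => [|s [b Hb]]; first by exists ord_max; rewrite inE.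
  have z0 : 0 < z.-1 by rewrite -ltnS prednK // ltnW.
  by exists (Some (Ordinal z0), b); rewrite inE.
elim: t => [|t IHt] x y.
  by have [->|xy] := eqVneq x y; [exact: connect0 | exact: connect1].
have csym := sym_connect_sym (@adj_sym (hgraph z t.+1)).
have same c u v : connect (@adj (hgraph z t.+1)) (c, u) (c, v).
  have /connectP[p] := IHt u v.
  elim: p u => [|w p IHp] u /=; first by move=> _ ->; exact: connect0.
  case/andP=> uw wp lp; apply: connect_trans (IHp _ wp lp).
  by apply: connect1; rewrite /= /step_adj /= eqxx uw.
have [b Hb] := bot t.
suff toh u : connect (@adj (hgraph z t.+1)) (hub (hgraph z t.+1)) u.
  by apply: connect_trans (toh y); rewrite csym.
case: u => -[i|] u; last exact: same.
apply: connect_trans (same (Some i) b u); apply: connect1.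
by rewrite /= /step_adj /hub_bottom /= !eqxx Hb.
Qed.

(* [enum_rank] totally orders the vertices, so every unordered pair of distinct
   vertices is counted exactly once. *)
Definition total_distance (G : rootedGraph) : nat :=
  \sum_(x : G) \sum_(y : G | enum_rank x < enum_rank y) dist x y.

Local Open Scope ring_scope.

Definition avg_path_length (R : realType) (G : rootedGraph) : R :=
  (total_distance G)%:R / (#|G|%:R * (#|G|%:R - 1) / 2).

(* Main.v *)
Require Import Defs.
From mathcomp Require Import all_boot all_order all_algebra.
From mathcomp Require Import all_classical all_reals all_analysis.
From mathcomp Require Import zify ring.

Set Implicit Arguments.
Unset Strict Implicit.
Unset Printing Implicit Defensive.

Import Order.TTheory GRing.Theory Num.Theory.
Import numFieldNormedType.Exports.
Import Defs.

(** The hub of the original copy separates it from the replicas, while every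
    bottom node is adjacent to the hub of its own copy; hence distances in the
    next graph are sums of distances to the hub and to the nearest bottom node,
    and distances inside a copy do not change.  Summing them gives linear
    recurrences whose solution is [z^(2t) (A t + B) + O(z^t)] for the ordered
    distance sum, with [A = 36 (z-1) / z^2]; dividing by [N^2 t ~ 9 z^(2t) t]
    gives the limit [A / 9]. *)

(** * Walks and functions measuring distance *)

Definition walk (G : rootedGraph) (n : nat) (x y : G) : Prop :=
  exists p : seq G, [/\ path (@adj G) x p, last x p = y & size p = n].

Lemma walk0 (G : rootedGraph) (x : G) : walk 0 x x.
Proof. by exists [::]. Qed.

Lemma walk1 (G : rootedGraph) (x y : G) : adj x y -> walk 1 x y.
Proof. by move=> xy; exists [:: y]; rewrite /= xy. Qed.

Lemma walk_cat (G : rootedGraph) (m n : nat) (x y z : G) :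
  walk m x y -> walk n y z -> walk (m + n) x z.
Proof.
move=> [p [xp lp <-]] [q [yq lq <-]]; exists (p ++ q).
by rewrite cat_path last_cat size_cat xp lp yq.
Qed.

Lemma walk_sym (G : rootedGraph) (n : nat) (x y : G) : walk n x y -> walk n y x.
Proof.
move=> [p [xp lp <-]]; elim: p x xp lp => [|w p IHp] x /=.
  by move=> _ ->; exact: walk0.
case/andP=> xw wp lp; rewrite -addn1.
by apply: walk_cat (IHp w wp lp) _; apply: walk1; rewrite adj_sym.
Qed.

Lemma walk_step (z : nat) (G : rootedGraph) (c : option 'I_z.-1) (n : nat)
    (x y : G) : walk n x y -> walk n ((c, x) : step z G) (c, y).
Proof.
move=> [p [xp lp <-]]; elim: p x xp lp => [|w p IHp] x /=.
  by move=> _ ->; exact: walk0.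
case/andP=> xw wp lp; rewrite -add1n; apply: walk_cat (IHp w wp lp).
by apply: walk1; rewrite /= /step_adj /= eqxx xw.
Qed.

(* Uniquely characterises [f] as the distance to the set [A]: the Lipschitz
   condition gives one inequality and the walks the other. *)
Definition is_setdist (G : rootedGraph) (A : {set G}) (f : G -> nat) : Prop :=
  [/\ forall x, x \in A -> f x = 0,
      forall x y, adj x y -> f x <= (f y).+1
    & forall x, exists2 a, a \in A & walk (f x) x a].

Lemma setdist_walk (G : rootedGraph) (A : {set G}) (f : G -> nat) (n : nat)
    (x y : G) : is_setdist A f -> walk n x y -> f x <= f y + n.
Proof.
move=> [_ lip _] [p [xp lp <-]]; elim: p x xp lp => [|w p IHp] x /=.
  by move=> _ ->; rewrite addn0.
case/andP=> xw wp lp; rewrite addnS.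
by apply: leq_trans (lip x w xw) _; rewrite ltnS; exact: IHp.
Qed.

(** Trades the search defining [dist] for an explicit formula; the walk of length [f x] also
    supplies the connectedness that [distP] requires. *)
Lemma dist_setdist (G : rootedGraph) (f : G -> nat) (x y : G) :
  is_setdist [set y] f -> dist x y = f x.
Proof.
move=> fP; have [f0 _ /(_ x)[a /set1P->] wk] := fP.
have [p [xp lp sp]] := wk.
have xy : connect (@adj G) x y by apply/connectP; exists p.
have [[q [xq lq sq]] minp] := distP xy.
apply/eqP; rewrite eqn_leq -{1}sp minp //= -sq.
by rewrite -[size q]add0n -(f0 y) ?inE //; apply: setdist_walk fP _; exists q.
Qed.

Definition is_metric (G : rootedGraph) (d : G -> G -> nat) : Prop :=
  (forall x y, d x y = d y x) /\ (forall y, is_setdist [set y] (d^~ y)).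

Lemma metric_walk (G : rootedGraph) (d : G -> G -> nat) (x y : G) :
  is_metric d -> walk (d x y) x y.
Proof. by move=> [_ /(_ y)[_ _ /(_ x)[a /set1P->]]]. Qed.

Lemma metricxx (G : rootedGraph) (d : G -> G -> nat) (x : G) :
  is_metric d -> d x x = 0.
Proof. by move=> [_ /(_ x)[d0 _ _]]; rewrite d0 ?inE. Qed.

Lemma setdist_metric (G : rootedGraph) (d : G -> G -> nat) (A : {set G})
    (f : G -> nat) (x y : G) :
  is_metric d -> is_setdist A f -> f x <= f y + d x y.
Proof. by move=> dP fP; exact: setdist_walk fP (metric_walk x y dP). Qed.

(** * Distances after one step of the construction *)

Section StepMetric.
Variables (z : nat) (G : rootedGraph) (d : G -> G -> nat) (bd : G -> nat).
Hypotheses (dP : is_metric d) (bdP : is_setdist (bottom G) bd).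
Hypothesis hubP : forall b, b \in bottom G -> adj b (hub G).

(* Two vertices of one replica are never closer through the hub, because any
   two bottom nodes are joined by a walk of length two inside the replica. *)
Definition step_dist (u v : step z G) : nat :=
  match u.1, v.1 with
  | None, None => d u.2 v.2
  | None, Some _ => d u.2 (hub G) + 1 + bd v.2
  | Some _, None => d v.2 (hub G) + 1 + bd u.2
  | Some i, Some j => if i == j then d u.2 v.2 else bd u.2 + 2 + bd v.2
  end.

(** The new bottom nodes lie in the replicas only, so from the original copy one must reach its hub
    and cross a connecting edge. *)
Definition step_bottom_dist (u : step z G) : nat :=
  if u.1 is Some _ then bd u.2 else (d u.2 (hub G)).+1.

Lemma le_metric_bottom (x y : G) : d x y <= bd x + 2 + bd y.
Proof.
have [_ _ wk] := bdP; have [a aB xa] := wk x; have [b bB yb] := wk y.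
have ay : d a y <= 2 + bd y.
  have := setdist_walk (dP.2 y) (walk_cat (walk_cat (walk1 (hubP aB))
    (walk_sym (walk1 (hubP bB)))) (walk_sym yb)).
  by rewrite metricxx.
have := setdist_walk (dP.2 y) xa.
by lia.
Qed.

Lemma hub_bottom_walk (i : 'I_z.-1) (b : G) : b \in bottom G ->
  walk 1 ((None, hub G) : step z G) (Some i, b).
Proof. by move=> bB; apply: walk1; rewrite /= /step_adj /hub_bottom /= !eqxx bB. Qed.

Lemma hub_replica_walk (i : 'I_z.-1) (x : G) :
  walk (1 + bd x) ((None, hub G) : step z G) (Some i, x).
Proof.
have [_ _ /(_ x)[b bB xb]] := bdP.
exact: walk_cat (hub_bottom_walk i bB) (walk_step _ (walk_sym xb)).
Qed.

Lemma step_dist_sym (u v : step z G) : step_dist u v = step_dist v u.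
Proof.
case: u v => [[i|] x] [[j|] y]; rewrite /step_dist //= ?[d y x]dP.1 //.
by rewrite [j == i]eq_sym; case: eqP => // _; lia.
Qed.

Lemma step_dist_walk (u v : step z G) : walk (step_dist u v) u v.
Proof.
have wON (i : 'I_z.-1) x y :
    walk (d x (hub G) + 1 + bd y) ((None, x) : step z G) (Some i, y).
  rewrite -addnA; apply: walk_cat (hub_replica_walk i y).
  exact: walk_step (metric_walk _ _ dP).
case: u v => [[i|] x] [[j|] y]; rewrite /step_dist /=.
- have [->|ij] := eqVneq; first exact: walk_step (metric_walk _ _ dP).
  (* The 2 counts the two connecting edges through the original hub. *)
  rewrite (_ : _ + _ = (1 + bd x) + (1 + bd y)); last by lia.
  exact: walk_cat (walk_sym (hub_replica_walk i x)) (hub_replica_walk j y).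
- exact/walk_sym/wON.
- exact: wON.
- exact: walk_step (metric_walk _ _ dP).
Qed.

(** Both orientations of a connecting edge appear because the Lipschitz inequality is one-sided. *)
Lemma step_adj_ind (P : step z G -> step z G -> Prop) :
  (forall c x y, adj x y -> P (c, x) (c, y)) ->
  (forall i b, b \in bottom G -> P (None, hub G) (Some i, b)) ->
  (forall i b, b \in bottom G -> P (Some i, b) (None, hub G)) ->
  forall u v : step z G, adj u v -> P u v.
Proof.
move=> Psame Phb Pbh [c x] [c' y] /or3P[].
- by case/andP=> /= /eqP -> xy; exact: Psame.
- by case/and4P=> /= /eqP -> /eqP ->; case: c' => // i _; exact: Phb.
- by case/and4P=> /= /eqP -> /eqP ->; case: c => // i _; exact: Pbh.
Qed.

Lemma step_dist_metric : is_metric step_dist.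
Proof.
have lip y u v : adj u v -> d u y <= (d v y).+1.
  by have [_ + _] := dP.2 y; apply.
have blip u v : adj u v -> bd u <= (bd v).+1 by have [_ + _] := bdP; apply.
have b0 b : b \in bottom G -> bd b = 0 by have [+ _ _] := bdP; apply.
have h0 := metricxx (hub G) dP.
split=> [|v]; first exact: step_dist_sym.
split=> [u /set1P->|u u' | u].
- by case: v => [[j|] y]; rewrite /step_dist /= ?eqxx metricxx.
- move: u u'; apply: step_adj_ind.
  + case=> [i|] x x' xx'; case: v => [[j|] y]; rewrite /step_dist /=.
    * have := lip y _ _ xx'; have := blip _ _ xx'.
      by case: ifP => _; lia.
    * by have := blip _ _ xx'; lia.
    * by have := lip (hub G) _ _ xx'; lia.
    * exact: lip.
  + move=> i b bB; case: v => [[j|] y]; rewrite /step_dist /= ?h0 ?(b0 b bB).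
    * case: ifP => _; last by lia.
      (* Target in the replica of [b]: [b] is itself a bottom node, so [bd y <= d b y]. *)
      have := setdist_metric y b dP bdP; rewrite (b0 b bB) [d y b]dP.1; lia.
    * by rewrite [d y _]dP.1; lia.
  + move=> i b bB; case: v => [[j|] y]; rewrite /step_dist /= ?h0 ?(b0 b bB).
    * case: ifP => _; last by lia.
      (* Target in the replica being left: the detour through the hub must not be a shortcut. *)
      by have := le_metric_bottom b y; rewrite (b0 b bB); lia.
    * by rewrite [d y _]dP.1; lia.
- by exists v; [rewrite inE | exact: step_dist_walk].
Qed.

Lemma step_bottom_distP : 1 < z ->
  is_setdist (bottom (step z G)) step_bottom_dist.
Proof.
move=> z_gt1; have [b0 blip bwalk] := bdP.
have z0 : 0 < z.-1 by lia.
split.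
- by case=> [[i|] x]; rewrite !inE //= => xB; exact: b0.
- apply: step_adj_ind => [[i|] x y xy|i b bB|i b bB];
    rewrite /step_bottom_dist /=.
  + exact: blip.
  + by have [_ /(_ x y xy) + _] := dP.2 (hub G).
  + by rewrite metricxx // b0.
  + by rewrite b0.
- case=> [[i|] x]; rewrite /step_bottom_dist /=.
    have [b bB xb] := bwalk x; exists (Some i, b); first by rewrite inE.
    exact: walk_step.
  (* Any bottom node of any replica will do, since the hub is adjacent to all of them. *)
  have [b bB _] := bwalk x; exists (Some (Ordinal z0), b); first by rewrite inE.
  rewrite -addn1; apply: walk_cat (hub_bottom_walk _ bB).
  exact: walk_step (metric_walk _ _ dP).
Qed.

Lemma step_bottom_adj_hub (u : step z G) :
  u \in bottom (step z G) -> adj u (hub (step z G)).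
Proof.
case: u => [[i|] x]; rewrite !inE //= => xB.
by rewrite /step_adj /hub_bottom /= !eqxx xB.
Qed.

(** * Distance sums after one step *)

Lemma sum_step (F : step z G -> nat) :
  \sum_u F u = \sum_x F (None, x) + \sum_(i < z.-1) \sum_x F (Some i, x).
Proof.
rewrite (eq_bigr (fun u => F (u.1, u.2))); last by case.
rewrite -(pair_bigA _ (fun c x => F (c, x))) /= (bigD1 None) //=; congr addn.
rewrite (reindex_omap Some id) /=; last by case.
by apply: eq_bigl => i; rewrite eqxx.
Qed.

Lemma sum_step_hub :
  \sum_u step_dist u (hub (step z G)) =
  \sum_x d x (hub G) + z.-1 * (#|G| + \sum_x bd x).
Proof.
rewrite sum_step /step_dist /=; congr addn.
rewrite sum_nat_const card_ord; congr muln.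
by rewrite big_split /= metricxx // sum_nat_const muln1.
Qed.

Lemma sum_step_bottom :
  \sum_u step_bottom_dist u =
  \sum_x d x (hub G) + #|G| + z.-1 * \sum_x bd x.
Proof.
rewrite sum_step /step_bottom_dist /= sum_nat_const card_ord; congr addn.
by under eq_bigr do rewrite -addn1; rewrite big_split /= sum_nat_const muln1.
Qed.

Lemma sum_sum_add (T : finType) (f g : T -> nat) (c : nat) :
  \sum_x \sum_y (f x + c + g y) =
  #|T| * (\sum_x f x + c * #|T| + \sum_y g y).
Proof.
under eq_bigr do rewrite big_split /= sum_nat_const.
rewrite big_split /= sum_nat_const -big_distrr /= big_split /= sum_nat_const.
ring.
Qed.

(** The ordered pairs of copies split into z diagonal blocks, 2(z-1) blocks joining the original to
    a replica, and (z-1)(z-2) blocks of distinct replicas. The hub and bottom sums then enter only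
    through H + (z-1)B. *)
Lemma sum_step_dist : 0 < z ->
  \sum_u \sum_v step_dist u v =
  z * \sum_x \sum_y d x y
  + 2 * z.-1 * #|G| * (\sum_x d x (hub G) + z.-1 * \sum_x bd x + z.-1 * #|G|).
Proof.
move=> z_gt0.
set S := \sum_x \sum_y d x y; set H := \sum_x d x (hub G).
set B := \sum_x bd x; set N := #|G|.
have out : \sum_x \sum_y (d x (hub G) + 1 + bd y) = N * (H + N + B).
  by rewrite sum_sum_add mul1n.
have across : \sum_x \sum_y (bd x + 2 + bd y) = N * (B + 2 * N + B).
  exact: sum_sum_add.
rewrite sum_step.
have -> : \sum_x \sum_v step_dist (None, x) v = S + z.-1 * (N * (H + N + B)).
  under eq_bigr do rewrite sum_step.
  rewrite big_split /= -[S]/(\sum_x \sum_y d x y); congr addn.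
  by rewrite /step_dist /= exchange_big /= sum_nat_const card_ord out.
have rep (i : 'I_z.-1) : \sum_x \sum_v step_dist (Some i, x) v =
    N * (H + N + B) + (S + z.-2 * (N * (B + 2 * N + B))).
  under eq_bigr do rewrite sum_step.
  rewrite big_split /= {1}/step_dist /= exchange_big /= out; congr addn.
  rewrite exchange_big /= (bigD1 i) //= /step_dist /= eqxx; congr addn.
  rewrite (eq_bigr (fun=> N * (B + 2 * N + B))); last first.
    by move=> j; rewrite eq_sym => /negPf ->; exact: across.
  by rewrite sum_nat_const cardC1 card_ord.
rewrite (eq_bigr _ (fun i _ => rep i)) sum_nat_const card_ord.
(* Removes the truncated predecessors; for z = 1 the factor [z.-1] vanishes. *)
case: z z_gt0 => [//|[|n]] _ /=; ring.
Qed.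

End StepMetric.

(** * The triangle, and ordered versus unordered pairs *)

Lemma triangle_dist_metric :
  is_metric (fun x y : triangle => (x != y) : nat).
Proof.
split=> [x y|y]; first by rewrite eq_sym.
split=> [x /set1P->|x w _|x]; first by rewrite eqxx.
  by case: (x == y).
exists y; first by rewrite inE.
have [->|xy] := eqVneq; first exact: walk0.
exact: walk1.
Qed.

Lemma triangle_bottom_distP :
  is_setdist (bottom triangle) (fun x => (x == hub triangle) : nat).
Proof.
split=> [x|x y _|x].
- by rewrite inE => /negPf ->.
- by case: eqP.
have [->|xh] := eqVneq; last by exists x; [rewrite inE | exact: walk0].
by exists ord_max; [rewrite inE | exact: walk1].
Qed.

(** Exchanging the variables in one of the two copies yields the pairs in reverse order; the
    diagonal contributes zero. *)
Lemma double_total_distance (G : rootedGraph) (d : G -> G -> nat) :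
  is_metric d -> 2 * total_distance G = \sum_x \sum_y d x y.
Proof.
move=> dP; have dE x y : dist x y = d x y by exact: dist_setdist (dP.2 y).
rewrite mul2n -addnn {2}/total_distance.
rewrite (exchange_big_dep xpredT) //= /total_distance -big_split /=.
apply: eq_bigr => x _.
rewrite [RHS](bigID (fun y => enum_rank x < enum_rank y)) /=.
congr addn; first by apply: eq_bigr => y _; rewrite dE.
rewrite [RHS](bigD1 x) ?ltnn //= metricxx // add0n; apply: eq_big => [y|y _].
  rewrite -leqNgt ltn_neqAle andbC; congr andb.
  by rewrite (inj_eq val_inj) (inj_eq enum_rank_inj).
by rewrite dE dP.1.
Qed.

(** * Closed forms *)

Section Totals.
Variables (R : numFieldType) (z : nat).
Hypothesis z_gt1 : 1 < z.
Local Open Scope ring_scope.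

(* The closed forms solve w' = z w + 2(z-1)N and S' = z S + 2(z-1)N(w + (z-1)N)
   with N = 3 z^t, where w is the distance sum from the hub plus z-1 times the
   distance sum from the bottom, and S is the sum over ordered pairs. *)
Lemma hgraph_sums (t : nat) :
  exists (d : hgraph z t -> hgraph z t -> nat) (bd : hgraph z t -> nat),
  [/\ is_metric d, is_setdist (bottom (hgraph z t)) bd,
      forall b, b \in bottom (hgraph z t) -> adj b (hub (hgraph z t)),
      ((\sum_x d x (hub (hgraph z t)))%:R + (z%:R - 1) * (\sum_x bd x)%:R =
       z%:R ^+ t * (z%:R + 1 + 6 * (z%:R - 1) * t%:R / z%:R) :> R)
    & ((\sum_x \sum_y d x y)%:R =
       z%:R ^+ t * (z%:R ^+ t * (36 * (z%:R - 1) / z%:R ^+ 2 * t%:R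
         + 24 * (z%:R - 2) / z%:R) + 6 - 24 * (z%:R - 2) / z%:R) :> R)].
Proof.
have z0 : z%:R != 0 :> R by rewrite pnatr_eq0; lia.
have zE : z.-1%:R = z%:R - 1 :> R by rewrite -subn1 natrB //; lia.
elim: t => [|t [d [bd [dP bdP hubP wE SE]]]].
  exists (fun x y => (x != y) : nat), (fun x => (x == hub triangle) : nat).
  split.
  - exact: triangle_dist_metric.
  - exact: triangle_bottom_distP.
  - by move=> b; rewrite inE.
  (* On the triangle H = 2 and B = 1, so w = z + 1. *)
  - by rewrite !big_ord_recl !big_ord0 /=; field.
  - by rewrite !big_ord_recl !big_ord0 /=; field.
exists (step_dist d bd), (step_bottom_dist d bd); split.
- exact: step_dist_metric.
- exact: step_bottom_distP.
- exact: step_bottom_adj_hub.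
- rewrite -[hgraph z t.+1]/(step z (hgraph z t)).
  rewrite sum_step_hub // sum_step_bottom card_hgraph; last by lia.
  rewrite !(natrD, natrM) zE natrX.
  move: wE; set H := (\sum_x d x _)%:R; set B := (\sum_x bd x)%:R => wE.
  (* The new w is zH + z(z-1)B + 2(z-1)N, so eliminating H makes B cancel. *)
  have -> : H = z%:R ^+ t * (z%:R + 1 + 6 * (z%:R - 1) * t%:R / z%:R)
     - (z%:R - 1) * B by rewrite -wE addrK.
  by rewrite (exprS _ t) -[t.+1%:R]natr1; field.
- rewrite -[hgraph z t.+1]/(step z (hgraph z t)).
  rewrite sum_step_dist ?card_hgraph //; try lia.
  rewrite !(natrD, natrM) zE natrX wE SE.
  by rewrite (exprS _ t) -[t.+1%:R]natr1; field.
Qed.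

End Totals.

(** * The limit *)

Local Open Scope classical_set_scope.
Local Open Scope ring_scope.

(** Both 2D and N(N-1) are divided by z^(2t), leaving only t and powers of 1/z that tend to zero. *)
Lemma avg_path_length_hgraph (R : realType) (z t : nat) : (1 < z)%N ->
  avg_path_length R (hgraph z t) =
  (36 * (z%:R - 1) / z%:R ^+ 2 * t%:R + 24 * (z%:R - 2) / z%:R
     + (6 - 24 * (z%:R - 2) / z%:R) * z%:R^-1 ^+ t) / (9 - 3 * z%:R^-1 ^+ t).
Proof.
move=> z_gt1; have [d [bd [dP _ _ _ SE]]] := hgraph_sums R z_gt1 t.
rewrite -(double_total_distance dP) natrM in SE.
have z0 : z%:R != 0 :> R by rewrite pnatr_eq0; lia.
have zt0 : z%:R ^+ t != 0 :> R by rewrite expf_neq0.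
have zt1 : 3 * z%:R ^+ t - 1 != 0 :> R.
  rewrite -natrX -natrM subr_eq0 (eqr_nat R _ 1).
  by have := expn_gt0 z t; lia.
rewrite /avg_path_length card_hgraph; last by lia.
rewrite natrM natrX exprVn.
have -> : (total_distance (hgraph z t))%:R =
  (2 * (total_distance (hgraph z t))%:R) / 2 :> R by field.
rewrite SE; field; rewrite z0 zt0 zt1 /= andbT.
(* The remaining side condition concerns 9 z^t - 3, which is 3(N-1). *)
rewrite (_ : _ - 3 = 3 * (3 * z%:R ^+ t - 1)); last by ring.
by rewrite mulf_neq0 ?pnatr_eq0.
Qed.

Theorem theorem3p7 (R : realType) (z : nat) (hz : (2 < z)%N) :
  (fun t : nat => avg_path_length R (hgraph z t) / t%:R) @ \oo
    --> (4 * (z%:R - 1) / z%:R ^+ 2 : R).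
Proof.
have z_gt1 : (1 < z)%N by lia.
have z0 : z%:R != 0 :> R by rewrite pnatr_eq0; lia.
(* Shifting the index avoids the division by zero at t = 0 and matches the harmonic sequence. *)
rewrite -cvg_shiftS.
pose A : R := 36 * (z%:R - 1) / z%:R ^+ 2.
pose B : R := 24 * (z%:R - 2) / z%:R.
pose q : R := z%:R^-1.
have q_cvg : (fun t => q ^+ t.+1) @ \oo --> (0 : R).
  have : (GRing.exp q : R^nat) @ \oo --> (0 : R).
    apply: cvg_expr; rewrite /q ger0_norm ?invr_ge0 ?ler0n //.
    by rewrite invf_lt1 ?ltr0n ?ltr1n //; lia.
  by rewrite -cvg_shiftS.
have h_cvg : (fun t : nat => t.+1%:R^-1) @ \oo --> (0 : R) := cvg_harmonic.
have -> : (fun t : nat => avg_path_length R (hgraph z t.+1) / t.+1%:R) =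
    (fun t : nat => (A + B * t.+1%:R^-1 + (6 - B) * (q ^+ t.+1 * t.+1%:R^-1))
      * (9 - 3 * q ^+ t.+1)^-1).
  apply/funext => t.
  rewrite avg_path_length_hgraph // -/A -/B -/q mulrAC; congr (_ * _); field.
  by rewrite addrC natr1 pnatr_eq0.
(* The limit A/9 is spelled out in the shape of the sequence, so that the limit rules apply term by
   term. *)
have -> : 4 * (z%:R - 1) / z%:R ^+ 2 =
    (A + B * 0 + (6 - B) * (0 * 0)) * (9 - 3 * 0)^-1 by rewrite /A /B; field.
apply: cvgM; last first.
  apply: cvgV; first by rewrite mulr0 subr0 pnatr_eq0.
  by apply: cvgB; [exact: cvg_cst | apply: cvgM => //; exact: cvg_cst].
apply: cvgD; last by apply: cvgM; [exact: cvg_cst | exact: cvgM].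
by apply: cvgD; [exact: cvg_cst | apply: cvgM => //; exact: cvg_cst].
Qed.
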